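(* Let $k_1,k_2$ be integers with $1\le k_1\le k_2$ and $k_2\ge 3$, and put $n=k_1+k_2+1$. If $n$ is not a prime, then there does not exist a perfect $B[-k_1,k_2](n^2)$ set.
   Context: For a positive integer $q$, $\mathbb{Z}_q$ is the ring of integers modulo $q$. For integers $a\le b$, $[a,b]=\{a,a+1,\dots,b\}$ and $[a,b]^\ast=[a,b]\setminus\{0\}$. For non-negative integers $0\le k_1\le k_2$ and a positive integer $q$, a set $B\subseteq\mathbb{Z}_q$ is a $B[-k_1,k_2](q)$ set (splitter set) if, for each $b\in B$, the set $\{ab \bmod q: a\in[-k_1,k_2]^\ast\}$ consists of $k_1+k_2$ distinct nonzero elements, and these sets are pairwise disjoint for distinct $b\in B$. Such a set is perfect if $|B|=(q-1)/(k_1+k_2)$; equivalently, every nonzero element of $\mathbb{Z}_q$ has a unique representation $ab$ with $a\in[-k_1,k_2]^\ast$, $b\in B$ (and $0$ has no such representation). *)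

(* Defs.v *)
From HB Require Import structures.
From mathcomp Require Import all_boot all_order all_algebra.
Unset Printing Implicit Defensive.
Import Order.TTheory GRing.Theory Num.Theory.
Local Open Scope ring_scope.

Definition mult_set (k1 k2 : nat) (a : int) : bool :=
  (- (k1%:Z) <= a) && (a <= k2%:Z) && (a != 0).

Definition mulmod (q : nat) (a b : int) : int := ((a * b) %% (q%:Z))%Z.

Definition splitter_set (k1 k2 q : nat) (B : {set 'I_q}) : Prop :=
  (forall b : 'I_q, b \in B -> forall a : int, mult_set k1 k2 a ->
      mulmod q a (nat_of_ord b)%:Z != 0)
  /\ (forall b b' : 'I_q, b \in B -> b' \in B ->
      forall a a' : int, mult_set k1 k2 a -> mult_set k1 k2 a' ->
      mulmod q a (nat_of_ord b)%:Z = mulmod q a' (nat_of_ord b')%:Z ->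
      b = b' /\ a = a').

(* Perfect: |B| = (q-1)/(k1+k2), stated without division. *)
Definition perfect_splitter_set (k1 k2 q : nat) (B : {set 'I_q}) : Prop :=
  splitter_set k1 k2 q B /\ (#|B| * (k1 + k2))%N = (q - 1)%N.

(* Main.v *)
Require Import Defs.
From mathcomp Require Import all_boot all_order all_algebra.
From mathcomp Require Import all_fingroup all_solvable all_field.
From mathcomp Require Import zify ring.

(** Write M for [-k1, k2] without 0 and n for k1 + k2 + 1. A perfect splitter
    set mod n^2 contains n units V, since each of the n residues 1 + n t is
    a multiple of a different unit; by counting, M * V covers each non multiple
    of n exactly once. Restricting to the multiples of a divisor d of n shows
    that the multipliers a with d a in M and the set V factor the non multiples
    of n / d modulo n^2 / d. With d = n / p this forces all prime divisors of n
    to be equal, since a second prime q must divide some such a with |a| < p.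

    If n = p^e with p odd and e >= 2, the units mod n^2 form a cyclic group that
    is the product of V and the units in M. By the irreducibility of the
    cyclotomic polynomial of p-power order, one of the two factors contains two
    elements congruent mod n^2 / p; this is impossible in M, where differences
    are less than n, and in V, where multiplication by p, an element of M, would
    identify their multiples.

    If n = 8 h is a power of 2, either V or its symmetrization, according to
    whether -2 h lies in M, is a set of representatives of the odd residues mod
    some q that contains no pair x, 3 x mod 2 q, which is impossible. *)

Set Implicit Arguments.
Unset Strict Implicit.
Unset Printing Implicit Defensive.
Import Order.TTheory GRing.Theory Num.Theory.
Local Open Scope ring_scope.

(** * Vanishing sums of roots of unity and factorizations of cyclic groups *)

(** The minimal polynomial of [z] over the rationals is cyclotomic, of degree [p.-1 * p ^ r].
    Subtracting from the relation the periodic extension of its last block, itself a relation,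
    leaves a smaller degree, hence zero. *)
Lemma sum_prim_root_periodic (p r : nat) (z : algC) (c : nat -> nat) :
  prime p -> (p ^ r.+1).-primitive_root z ->
  \sum_(0 <= x < p ^ r.+1) (c x)%:R * z ^+ x = 0 ->
  forall x, (x < p ^ r.+1)%N -> c x = c (x %% p ^ r + p.-1 * p ^ r)%N.
Proof.
move=> p_pr prim_z sum0; set m := (p ^ r)%N.
have p_gt1 := prime_gt1 p_pr.
have m_gt0 : (0 < m)%N by rewrite expn_gt0 prime_gt0.
have defN : (p ^ r.+1 = p * m)%N by rewrite expnS.
have zm1 : (z ^+ m) ^+ p = 1.
  by rewrite -exprM mulnC -defN (prim_expr_order prim_z).
have zm_neq1 : z ^+ m - 1 != 0.
  rewrite subr_eq0 -(expr0 z) (eq_prim_root_expr prim_z) mod0n modn_small.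
    by rewrite -lt0n.
  by rewrite defN -[X in (X < _)%N]mul1n ltn_pmul2r.
have geom0 : \sum_(i < p) (z ^+ m) ^+ i = 0.
  by apply: (mulfI zm_neq1); rewrite -subrX1 zm1 subrr mulr0.
pose c' x : nat := c (x %% m + p.-1 * m)%N.
have sum'0 : \sum_(0 <= x < p ^ r.+1) (c' x)%:R * z ^+ x = 0 :> algC.
  pose S := \sum_(0 <= y < m) (c (y + p.-1 * m)%N)%:R * z ^+ y.
  rewrite defN big_nat_mul (eq_bigr (fun i => S * (z ^+ m) ^+ i)).
    by rewrite big_mkord -mulr_sumr geom0 mulr0.
  move=> i _; rewrite -{1}[(i * m)%N]add0n big_addn mulSn addnK mulr_suml.
  rewrite !big_nat; apply: eq_bigr => y /andP[_ lt_y].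
  rewrite /c' [(y + i * m)%N]addnC modnMDl modn_small //.
  by rewrite [(i * m + y)%N]addnC exprD mulrA (mulnC i) exprM.
(* [D] vanishes at z and its degree is less than that of the minimal
   polynomial, because [c - c'] is zero on the last block of length m. *)
pose D := \poly_(x < p.-1 * m) ((c x)%:R - (c' x)%:R : rat).
have D0 : D = 0.
  have [q [Dq mon_q] dv_q] := minCpolyP z.
  have size_q : size q = (p.-1 * m).+1.
    have -> : size q = size (minCpoly z) by rewrite Dq size_map_poly.
    by rewrite (minCpoly_cyclotomic prim_z) size_cyclotomic totient_pfactor.
  have : q %| D.
    rewrite -dv_q /root; apply/eqP.
    rewrite (@horner_coef_wide _ (p.-1 * m)) ?size_map_poly ?size_poly //.
    have : \sum_(0 <= x < p ^ r.+1) (c x)%:R * z ^+ x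
           - \sum_(0 <= x < p ^ r.+1) (c' x)%:R * z ^+ x = 0 :> algC.
      by rewrite sum0 sum'0 subrr.
    rewrite -sumrB big_mkord.
    have -> : (p ^ r.+1 = p.-1 * m + m)%N.
      by rewrite defN -[X in (X * m = _)%N](prednK (ltnW p_gt1)) mulSn addnC.
    rewrite big_split_ord /= [X in _ + X]big1 ?addr0 => [|i _].
      move=> eq0; rewrite -[RHS]eq0; apply: eq_bigr => i _.
      by rewrite coef_map coef_poly ltn_ord /= rmorphB /= !ratr_nat mulrBl.
    by rewrite /c' modnMDl modn_small ?[(i + _)%N]addnC ?subrr ?mul0r.
  apply: contraTeq => nzD; apply/negP => /(dvdp_leq nzD).
  by rewrite size_q leqNgt ltnS size_poly.
move=> x lt_x; rewrite -/(c' x); case: (ltnP x (p.-1 * m)) => [lt_xm | le_xm].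
  have /polyP/(_ x) := D0; rewrite coef_poly lt_xm coef0 => /eqP.
  by rewrite subr_eq0 eqr_nat => /eqP.
suff modx : (x %% m)%N = (x - p.-1 * m)%N by rewrite /c' modx subnK.
rewrite -{1}(subnK le_xm) addnC modnMDl modn_small //.
by rewrite ltn_subLR // -mulSnr prednK ?(ltnW p_gt1) // -defN.
Qed.

(* With a primitive character psi of order [p ^ r.+1], one factor of the
   factorization has psi-sum zero, hence meets the fibres of psi over a full
   coset of the p-th roots of unity; as [m < p], two of the p elements so
   obtained also agree in the complement of order [m]. *)
Lemma cyclic_factorization (gT : finGroupType) (p r m : nat) (A B : {set gT}) :
  prime p -> (m < p)%N -> #|[set: gT]| = (m * p ^ r.+1)%N -> cyclic [set: gT] ->
  (A * B)%g = [set: gT] ->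
  {in setX A B &, injective (fun u => (u.1 * u.2)%g)} ->
  exists2 C, C = A \/ C = B &
    exists x y, [/\ x \in C, y \in C, x != y & (x ^+ p = y ^+ p)%g].
Proof.
move=> p_pr lt_mp card_gT /cyclicP[g defG] AB injAB.
have ordg : #[g]%g = (m * p ^ r.+1)%N by rewrite orderE -defG.
set N := (p ^ r.+1)%N in card_gT ordg *.
(* [l] is a discrete logarithm to base [g]. It is additive modulo the group order, hence modulo [N],
   so [psi] is multiplicative. *)
have log_ex (x : gT) : exists i, x == (g ^+ i)%g.
  have /cycleP[i ->] : x \in <[g]>%g by rewrite -defG inE.
  by exists i.
pose l x := xchoose (log_ex x).
have gl x : (g ^+ l x)%g = x by apply/esym/eqP; exact: (xchooseP (log_ex x)).
have lM x y : l (x * y)%g = (l x + l y)%N %[mod N].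
  have /eqP : (g ^+ l (x * y) = g ^+ (l x + l y))%g by rewrite expgD !gl.
  rewrite eq_expg_mod_order ordg => /eqP eq_mN.
  by rewrite -[LHS](modn_dvdm _ (dvdn_mull m (dvdnn N))) eq_mN modn_dvdm ?dvdn_mull.
have N_gt0 : (0 < N)%N by rewrite expn_gt0 prime_gt0.
have [z prim_z] := C_prim_root_exists N_gt0.
pose psi x := z ^+ l x.
have psiM x y : psi (x * y)%g = psi x * psi y.
  by rewrite /psi -exprD; apply/eqP; rewrite (eq_prim_root_expr prim_z) lM.
have lg : l g = 1%N %[mod N].
  have : (g ^+ l g == g ^+ 1)%g by rewrite gl expg1.
  rewrite eq_expg_mod_order ordg => /eqP eq_mN.
  by rewrite -[LHS](modn_dvdm _ (dvdn_mull m (dvdnn N))) eq_mN modn_dvdm ?dvdn_mull.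
have N_gt1 : (1 < N)%N by rewrite -[1%N](exp1n r.+1) ltn_exp2r ?prime_gt1.
have psi_g : psi g - 1 != 0.
  rewrite subr_eq0 -(expr0 z) (eq_prim_root_expr prim_z) lg mod0n.
  by rewrite modn_small.
have sumG : \sum_x psi x = 0.
  apply: (mulfI psi_g); rewrite mulr0 mulrBl mul1r; apply/eqP.
  rewrite subr_eq0 mulr_sumr [X in _ == X](reindex_inj (mulgI g)) /=.
  by apply/eqP/eq_bigr => x _; rewrite psiM.
(* Unique factorization turns the product of the two sums into the sum over the group. *)
have sumAB : (\sum_(a in A) psi a) * (\sum_(b in B) psi b) = 0.
  rewrite -[RHS]sumG mulr_suml; under eq_bigr do rewrite mulr_sumr.
  rewrite pair_big /=; transitivity (\sum_(x in (A * B)%g) psi x); last first.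
    by rewrite AB; apply: eq_bigl => x; rewrite inE.
  have -> : (A * B)%g = [set (u.1 * u.2)%g | u in setX A B].
    apply/setP => x; apply/mulsgP/imsetP => [[a b Aa Bb ->] | [[a b] /=]].
      by exists (a, b); rewrite ?inE ?Aa.
    by rewrite inE => /andP[Aa Bb] ->; exists a b.
  rewrite big_imset //=; apply: eq_big => [[a b] | [a b] _]; first by rewrite inE.
  by rewrite psiM.
have key (C : {set gT}) : C != set0 -> \sum_(a in C) psi a = 0 ->
    exists x y, [/\ x \in C, y \in C, x != y & (x ^+ p = y ^+ p)%g].
  case/set0Pn=> a0 Ca0 sumC.
  pose c y := #|[set a in C | l a %% N == y]%N|.
  have sumc : \sum_(0 <= y < N) (c y)%:R * z ^+ y = 0.
    rewrite big_mkord -[RHS]sumC.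
    rewrite [RHS](partition_big (fun a => Ordinal (ltn_pmod (l a) N_gt0)) predT) //=.
    apply: eq_bigr => y _; rewrite (eq_bigr (fun=> z ^+ y)) => [|a /andP[_ /eqP <-]].
      rewrite sumr_const mulr_natl; congr (_ *+ _); rewrite /c cardsE.
      by apply: eq_card => a.
    by rewrite prim_expr_mod.
  have per := sum_prim_root_periodic p_pr prim_z sumc.
  set M := (p ^ r)%N in per; have M_gt0 : (0 < M)%N by rewrite expn_gt0 prime_gt0.
  have defN : N = (p * M)%N by rewrite /N expnS.
  pose x0 := (l a0 %% N)%N; pose y := (x0 %% M)%N.
  (* The fibre of [a0] is nonempty; by periodicity so is every fibre over an exponent congruent to
     [x0] modulo [M]. *)
  have c_gt0 (j : 'I_p) : (0 < c (y + j * M))%N.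
    have lt_N : (y + j * M < N)%N.
      rewrite defN; apply: (@leq_trans (j.+1 * M)); last by rewrite leq_mul2r ltn_ord orbT.
      by rewrite mulSn ltn_add2r ltn_pmod.
    have eqM : ((y + j * M) %% M = x0 %% M)%N by rewrite addnC modnMDl modn_mod.
    rewrite per // eqM -per ?ltn_pmod //.
    by apply/card_gt0P; exists a0; rewrite inE Ca0 eqxx.
  pose f j := xchoose (elimT card_gt0P (c_gt0 j)).
  have fP j : f j \in C /\ (l (f j) %% N = y + j * M)%N.
    have := xchooseP (elimT card_gt0P (c_gt0 j)); rewrite inE -/(f j).
    by case/andP=> -> /eqP.
  have m_gt0 : (0 < m)%N.
    by have := order_gt0 g; rewrite ordg muln_gt0 => /andP[].
  have [i [j [neq_ij eq_m]]] : exists i j : 'I_p,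
      i != j /\ (l (f i) = l (f j) %[mod m]).
    pose h (i : 'I_p) := Ordinal (ltn_pmod (l (f i)) m_gt0).
    have /injectivePn[i [j neq_ij /(congr1 val)/= eq_h]] : ~~ injectiveb h.
      by apply/negP => /injectiveP/leq_card; rewrite !card_ord leqNgt lt_mp.
    by exists i, j.
  exists (f i), (f j); have [Ci li] := fP i; have [Cj lj] := fP j; split=> //.
    apply: contra neq_ij => /eqP eq_f; apply/eqP/val_inj/eqP.
    by rewrite -(eqn_pmul2r M_gt0) -(eqn_add2l y) -li -lj eq_f.
  have eq_M : l (f i) = l (f j) %[mod M].
    have dvdMN : (M %| N)%N by rewrite defN dvdn_mull.
    by rewrite -(modn_dvdm _ dvdMN) li -[RHS](modn_dvdm _ dvdMN) lj
       ![(y + _)%N]addnC !modnMDl.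
  have co_mM : coprime m M.
    rewrite coprimeXr // coprime_sym prime_coprime //.
    by apply/negP => /(dvdn_leq m_gt0); rewrite leqNgt lt_mp.
  (* A p-th power multiplies logarithms by [p], which lifts this congruence to one modulo the group
     order. *)
  have /eqP eq_mM : l (f i) == l (f j) %[mod m * M].
    by rewrite chinese_remainder // eq_m eq_M !eqxx.
  rewrite -(gl (f i)) -(gl (f j)) -!expgM; apply/eqP.
  by rewrite eq_expg_mod_order ordg defN mulnCA ![(l _ * p)%N]mulnC -!muln_modr eq_mM.
have [Aneq0 Bneq0] : A != set0 /\ B != set0.
  have /mulsgP[a b Aa Bb _] : 1%g \in (A * B)%g by rewrite AB inE.
  by split; apply/set0Pn; [exists a | exists b].
move/eqP: sumAB; rewrite mulf_eq0 => /orP[] /eqP sum0.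
  by exists A; [left | apply: key Aneq0 sum0].
by exists B; [right | apply: key Bneq0 sum0].
Qed.

(** * Units and p-th powers modulo powers of an odd prime *)

(** The unit group is the automorphism group of a cyclic p-group, whose structure is known. The
    structure theorem treats order [p] apart, so [k = 0] relies on cyclicity modulo a prime. *)
Lemma units_Zp_odd_pfactor_cyclic (p k : nat) :
  prime p -> odd p -> cyclic (units_Zp (p ^ k.+1)).
Proof.
move=> p_pr odd_p; set q := (p ^ k.+1)%N.
have q_gt1 : (1 < q)%N by rewrite -[1%N](exp1n k.+1) ltn_exp2r ?prime_gt1.
case: (posnP k) => [k0 | k_gt0].
  by rewrite /q k0 expn1 units_Zp_cyclic.
pose G : {group 'I_q.-1.+1} := [set: 'I_q.-1.+1]%G.
have cardG : #|G| = q by rewrite cardsT card_ord prednK // ltnW.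
have pG : (p.-group G)%g by rewrite /pgroup cardG pnatX pnat_id.
have cycG : cyclic G by apply/cyclicP; exists Zp1; apply: Zp_cycle.
have ntG : G :!=: 1%g by rewrite -cardG_gt1 cardG.
have [mm [_ _]] := cyclic_pgroup_Aut_structure pG cycG ntG.
have -> : ((logn p #|G|).-1 == 0)%N = false.
  by rewrite cardG pfactorK // eqn0Ngt k_gt0.
rewrite odd_p => -[t [_ _ _ [[cycA _] _ _]]].
have [a defG] := cyclicP cycG.
have orda : #[a]%g = q by rewrite orderE -defG cardG.
rewrite defG -(isog_cyclic (Zp_unit_isog a)) in cycA.
by rewrite orda in cycA.
Qed.

Lemma intr_Zp_eq0 (q : nat) (x : int) :
  (1 < q)%N -> ((x%:~R : 'Z_q) == 0) = (q %| x)%Z.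
Proof.
move=> q_gt1.
have nat_case (m : nat) : ((m%:R : 'Z_q) == 0) = (q %| m)%N.
  by rewrite -val_eqE /= val_Zp_nat.
case: (intP x) => [|n|n]; first by rewrite dvdz0 eqxx.
  by rewrite -pmulrn nat_case.
by rewrite rmorphN /= oppr_eq0 -pmulrn nat_case dvdzE abszN.
Qed.

(** Fermat gives [p %| x - y]. The binomial expansion then factors [x ^ p - y ^ p] as [p * (x - y)]
    times a number congruent to [y ^ p.-1] modulo [p], hence prime to [p]. *)
Lemma dvdz_sub_expp (p k : nat) (x y : int) :
  prime p -> odd p -> ~~ (p %| y)%Z ->
  ((p ^ k.+1)%N %| x ^+ p - y ^+ p)%Z -> ((p ^ k)%N %| x - y)%Z.
Proof.
move=> p_pr odd_p ndvd_y dvd_pow.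
have pchar_p : p \in [pchar 'F_p] by rewrite pchar_Fp.
have /dvdzP[c def_c] : (p %| x - y)%Z.
  have : (p %| x ^+ p - y ^+ p)%Z.
    by apply: dvdz_trans dvd_pow; rewrite dvdzE /= expnS dvdn_mulr.
  rewrite !(dvdz_pcharf pchar_p) !rmorphB !rmorphXn /=.
  have frob (a : 'F_p) : a ^+ p = a by rewrite -[RHS]expf_card card_Fp.
  by rewrite !frob.
have [w def_pow] : exists w,
    x ^+ p - y ^+ p = (p%:Z * (x - y)) * (y ^+ p.-1 + p%:Z * w).
  case: p p_pr odd_p def_c {pchar_p ndvd_y dvd_pow} => [|[|[|p']]] // p_pr odd_p.
  set p := p'.+3 => def_c; set d := x - y in def_c *.
  have -> : x = y + d by rewrite addrC subrK.
  rewrite exprDn big_ord_recl big_ord_recl /= subn0 subn1 bin0 bin1.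
  rewrite expr0 mulr1 expr1 mulr1n.
  rewrite [y ^+ p + _]addrC addrK.
  suff /dvdzP[w ->] : (p%:Z * d * p%:Z %| \sum_(i < p'.+2)
      (y ^+ (p - bump 0 (bump 0 i)) * d ^+ bump 0 (bump 0 i))
        *+ 'C(p, bump 0 (bump 0 i)))%Z.
    by exists w; rewrite -mulr_natr natz; ring.
  elim/big_rec: _ => [|i s _ dvd_s]; first exact: dvdz0.
  apply: rpredD => //; rewrite /bump !add1n -mulrnAr dvdz_mull //.
  have := ltn_ord i; rewrite leq_eqVlt => /orP[/eqP [eq_i] | lt_i].
    (* The top term has binomial coefficient 1, but as [p] is at least 3 it contains [d ^ 2] besides
       one factor [d], and [p] divides [d]. *)
    rewrite eq_i binn mulr1n; apply/dvdzP; exists (d ^+ p' * c ^+ 2).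
    have -> : d ^+ p'.+3 = d ^+ p' * (d * d) * d by rewrite !exprSr !mulrA.
    have -> : d * d = (c * p%:Z) * (c * p%:Z) by rewrite -def_c.
    by ring.
  have /dvdnP[e ->] : (p %| 'C(p, i.+2))%N by apply: prime_dvd_bin.
  rewrite -mulr_natr natz PoszM; apply/dvdzP; exists (d ^+ i * c * e%:Z).
  by rewrite !exprS mulrCA {1}def_c; ring.
have p_neq0 : p%:Z != 0 by rewrite eqz_nat -lt0n prime_gt0.
move: dvd_pow; rewrite def_pow expnS PoszM -mulrA dvdz_mul2l // Gauss_dvdzl //.
rewrite coprimezE absz_nat coprimeXl // prime_coprime //.
apply: contra ndvd_y => dvd_sum.
have : (p %| y ^+ p.-1)%Z by rewrite -(rpredDr _ (dvdz_mulr w (dvdzz p))).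
by rewrite !dvdzE abszX Euclid_dvdX // => /andP[].
Qed.

(** * The units in a perfect splitter set *)

(* [V] lists the elements of a perfect splitter set that are coprime to [n]. *)
Definition unit_factorization (k1 k2 n : nat) (V : seq int) : Prop :=
  [/\ forall b, b \in V -> coprimez n b,
      forall a a' b b', mult_set k1 k2 a -> mult_set k1 k2 a' ->
        b \in V -> b' \in V -> ((n ^ 2)%N %| a * b - a' * b')%Z ->
        a = a' /\ b = b'
    & forall x, ~~ (n %| x)%Z ->
        exists a b, [/\ mult_set k1 k2 a, b \in V & ((n ^ 2)%N %| x - a * b)%Z]].

Lemma perfect_unit_factorization (k1 k2 n : nat) (B : {set 'I_(n ^ 2)}) :
  n = (k1 + k2 + 1)%N -> (1 < n)%N -> perfect_splitter_set k1 k2 (n ^ 2) B ->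
  exists V, unit_factorization k1 k2 n V.
Proof.
move=> def_n n_gt1 [[splB0 splB] cardB].
set q := (n ^ 2)%N in B splB0 splB cardB *.
have n_gt0 := ltnW n_gt1.
have q_gt1 : (1 < q)%N by rewrite -[1%N](exp1n 2) ltn_exp2r.
have q_gt0 : (0 < q)%N by exact: ltnW.
have q_neq0 : q%:Z != 0 by rewrite eqz_nat -lt0n ltnW.
have dvd_nq : (n %| q)%N by rewrite /q expnS dvdn_mulr.
have lt_k1n : (k1 < n)%N by rewrite def_n; lia.
(* Index [i] stands for the multiplier [i - k1]; [k0] is the index of the excluded multiplier 0. *)
pose k0 := Ordinal lt_k1n.
pose a (i : 'I_n) : int := i%:Z - k1%:Z.
have aP i : i != k0 -> mult_set k1 k2 (a i).
  rewrite -val_eqE /= /mult_set /a => neq_i; have := ltn_ord i; lia.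
have F_lt (u : 'I_n * 'I_q) : (`|mulmod q (a u.1) (u.2 : nat)%:Z| < q)%N.
  by rewrite -ltz_nat gez0_abs ?modz_ge0 // ltz_pmod // ltz_nat.
pose F u := Ordinal (F_lt u).
have FE (u : 'I_n * 'I_q) : (F u : nat)%:Z = mulmod q (a u.1) (u.2 : nat)%:Z.
  by rewrite /= gez0_abs ?modz_ge0.
have Fdvd (u : 'I_n * 'I_q) : (q %| a u.1 * (u.2 : nat)%:Z - (F u : nat)%:Z)%Z.
  by rewrite FE /mulmod -eqz_mod_dvd modz_mod.
pose X (C : {set 'I_q}) := setX [set~ k0] C.
have cardX C : #|X C| = (n.-1 * #|C|)%N by rewrite cardsX cardsC1 card_ord.
have injF : {in X B &, injective F}.
  move=> [i b] [i' b']; rewrite !inE /= => /andP[ik Bb] /andP[i'k Bb'] eqF.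
  have := congr1 (fun x : 'I_q => (x : nat)%:Z) eqF; rewrite !FE /=.
  case/(splB b b' Bb Bb' _ _ (aP _ ik) (aP _ i'k)) => -> eq_a; congr (_, _).
  by apply: val_inj; move: eq_a; rewrite /a /=; lia.
have onto0 : F @: X B = [set~ Ordinal q_gt0].
  apply/eqP; rewrite eqEcard card_in_imset // cardX cardsC1 card_ord.
  apply/andP; split; last by rewrite -subn1 -cardB mulnC def_n addn1.
  apply/subsetP=> _ /imsetP[[i b]] /[!inE] /= /andP[ik Bb] ->.
  have := splB0 b Bb _ (aP _ ik); apply: contra => /eqP/(congr1 val).
  by rewrite /= => /eqP; rewrite absz_eq0.
pose V := [set b in B | coprime n b].
have sVB : V \subset B by apply/subsetP => b; rewrite inE => /andP[].
have cardV : (n <= #|V|)%N.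
  pose T := [set j : 'I_q | (j %% n == 1)%N].
  pose P1 := [set u in X B | (F u %% n == 1)%N].
  apply: (@leq_trans #|T|).
    have t_lt (t : 'I_n) : (t * n + 1 < q)%N.
      have := ltn_ord t; rewrite /q expnS expn1; nia.
    rewrite -[leqLHS]card_ord -(card_imset predT (_ : injective (fun t => Ordinal (t_lt t)))).
      apply/subset_leq_card/subsetP => _ /imsetP[t _ ->].
      by rewrite inE /= modnMDl modn_small.
    move=> t t' /(congr1 val) /= /eqP; rewrite eqn_add2r eqn_pmul2r // => /eqP.
    exact: val_inj.
  apply: (@leq_trans #|P1|).
    apply: leq_trans (leq_imset_card F P1); apply/subset_leq_card/subsetP => j.
    rewrite inE => j1; have : j \in F @: X B.
      rewrite onto0 !inE; apply: contraTneq j1 => -> /=.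
      by rewrite mod0n.
    by case/imsetP=> u Xu def_j; apply/imsetP; exists u; rewrite // inE Xu -def_j.
  have P1dvd (u : 'I_n * 'I_q) : u \in P1 -> (n %| a u.1 * (u.2 : nat)%:Z - 1)%Z.
    rewrite inE => /andP[_ F1].
    have -> : a u.1 * (u.2 : nat)%:Z - 1
        = (a u.1 * (u.2 : nat)%:Z - (F u : nat)%:Z) + ((F u : nat)%:Z - 1) by ring.
    apply: rpredD; first by apply: dvdz_trans (Fdvd u); rewrite dvdzE.
    by rewrite -eqz_mod_dvd !modz_nat (eqP F1) modn_small.
  have P1cop (u : 'I_n * 'I_q) : u \in P1 -> coprimez n (u.2 : nat)%:Z.
    move=> /P1dvd/dvdzP[c def_c]; apply/coprimezP.
    by exists (- c, a u.1); rewrite /= -[RHS](subrK (a u.1 * (u.2 : nat)%:Z)); lia.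
  (* Two multipliers that both invert [b] modulo [n] agree modulo [n], and multipliers differ by
     less than [n]. *)
  have inj2 : {in P1 &, injective snd}.
    move=> [i b] [i' b'] Pu Pu' /= eq_b; subst b'; congr (_, _).
    have := rpredB (P1dvd _ Pu) (P1dvd _ Pu').
    rewrite /= opprB addrA subrK -mulrBl Gauss_dvdzl; last exact: (P1cop _ Pu).
    rewrite /a opprB addrA subrK dvdzE => /= dvd_n; apply: val_inj => /=.
    have := ltn_ord i; have := ltn_ord i'.
    case: (posnP `|i%:Z - i'%:Z|) => [|gt0]; first by lia.
    by have := dvdn_leq gt0 dvd_n; lia.
  rewrite -(card_in_imset inj2); apply/subset_leq_card/subsetP => _ /imsetP[u Pu ->].
  have := P1cop _ Pu; rewrite inE coprimezE => ->; rewrite andbT.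
  by move: Pu; rewrite !inE => /andP[/andP[]].
pose Y := [set j : 'I_q | ~~ (n %| j)%N].
have cardY : (#|Y| <= n.-1 * n)%N.
  have t_lt (t : 'I_n) : (t * n < q)%N by rewrite /q expnS expn1 ltn_pmul2r.
  have : (n <= #|~: Y|)%N.
    rewrite -[leqLHS]card_ord -(card_imset predT (_ : injective (fun t => Ordinal (t_lt t)))).
      apply/subset_leq_card/subsetP => _ /imsetP[t _ ->].
      by rewrite !inE /= dvdn_mull.
    move=> t t' /(congr1 val) /= /eqP; rewrite eqn_pmul2r // => /eqP.
    exact: val_inj.
  have : (#|Y| + #|~: Y| = n * n)%N by rewrite cardsC card_ord /q expnS expn1.
  by rewrite -subn1 mulnBl mul1n; lia.
(* A multiplier is not divisible by [n], so neither is its product with a unit. The at least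
   [n.-1 * n] such products exhaust [Y]. *)
have ontoY : F @: X V = Y.
  apply/eqP; rewrite eqEcard; apply/andP; split.
    apply/subsetP => _ /imsetP[[i b]] /[!inE] /= /andP[ik /andP[_ cop_b]] ->.
    apply/negP => /= dvd_F.
    have : (n %| a i * (b : nat)%:Z)%Z.
      rewrite -(subrK (F (i, b) : nat)%:Z (a i * (b : nat)%:Z)).
      apply: rpredD; last by rewrite dvdzE.
      by apply: dvdz_trans (Fdvd (i, b)); rewrite dvdzE.
    rewrite Gauss_dvdzl // dvdzE /= => dvd_a.
    have := aP _ ik; rewrite /mult_set => /andP[/andP[ge_a le_a] neq_a].
    by have := dvdn_leq _ dvd_a; rewrite absz_gt0 neq_a => /(_ isT); lia.
  rewrite card_in_imset; first by rewrite cardX (leq_trans cardY) // leq_mul2l cardV orbT.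
  by apply: sub_in2 injF => u; rewrite !inE => /andP[-> /andP[->]].
exists [seq (val b)%:Z | b <- enum V]; split.
- by move=> _ /mapP[b] /[!mem_enum] /[!inE] /andP[_ cop_b] ->.
- move=> x x' _ _ Mx Mx' /mapP[b] /[!mem_enum] Vb -> /mapP[b'] /[!mem_enum] Vb' ->.
  rewrite -eqz_mod_dvd => /eqP eq_q.
  have [-> ->] := splB b b' (subsetP sVB _ Vb) (subsetP sVB _ Vb') x x' Mx Mx' eq_q.
  by [].
move=> x ndvd_x; have x_lt : (`|(x %% q)%Z| < q)%N.
  by rewrite -ltz_nat gez0_abs ?modz_ge0 // ltz_pmod // ltz_nat.
have defx : (`|(x %% q)%Z|%N)%:Z = (x %% q)%Z by rewrite gez0_abs ?modz_ge0.
have dvd_x : (q %| x - (x %% q)%Z)%Z by rewrite -eqz_mod_dvd modz_mod.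
have : Ordinal x_lt \in F @: X V.
  rewrite ontoY inE /=; apply: contra ndvd_x => dvd_n.
  rewrite -(subrK (x %% q)%Z x) rpredD //; first by apply: dvdz_trans dvd_x; rewrite dvdzE.
case/imsetP=> [[i b]] /[!inE] /= /andP[ik Vb] def_x.
exists (a i), (b : nat)%:Z; split; first exact: aP.
  by apply: map_f; rewrite mem_enum inE.
have def_x' : (x %% q)%Z = (F (i, b) : nat)%:Z by rewrite -def_x /= defx.
rewrite -(subrK (x %% q)%Z x) -addrA rpredD // def_x' -opprB rpredN.
exact: (Fdvd (i, b)).
Qed.

(** In the factorization of [d * x], [d] divides [a * b] and is coprime to [b], hence divides [a].
    As [n ^ 2 = d * (n * t)], everything can be divided by [d]. *)
Lemma unit_factorization_dvd (k1 k2 n d t : nat) (V : seq int) :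
  unit_factorization k1 k2 n V -> n = (d * t)%N -> (0 < n)%N ->
  (forall x, ~~ (t %| x)%Z -> exists a b,
     [/\ mult_set k1 k2 (d%:Z * a), b \in V & ((n * t)%N %| x - a * b)%Z]) /\
  (forall a a' b b', mult_set k1 k2 (d%:Z * a) -> mult_set k1 k2 (d%:Z * a') ->
     b \in V -> b' \in V -> ((n * t)%N %| a * b - a' * b')%Z -> a = a' /\ b = b').
Proof.
move=> [copV injV ontoV] def_n n_gt0.
have d_gt0 : (0 < d)%N by move: n_gt0; rewrite def_n muln_gt0 => /andP[].
have d_neq0 : d%:Z != 0 by rewrite eqz_nat -lt0n.
have def_q : (n ^ 2)%N%:Z = d%:Z * (n * t)%N%:Z.
  by rewrite -PoszM mulnCA expnS expn1 {2}def_n.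
split=> [x ndvd_x | a a' b b' Ma Ma' Vb Vb' dvd_ab].
  have [|a [b [Ma Vb]]] := ontoV (d%:Z * x).
    by rewrite def_n PoszM dvdz_mul2l.
  rewrite def_q => dvd_xab.
  have : (d %| a * b)%Z.
    rewrite -[a * b](subKr (d%:Z * x)) rpredB //; first exact: dvdz_mulr.
    by apply: dvdz_trans dvd_xab; exact: dvdz_mulr.
  have cop_db : coprimez d b.
    by apply: coprimez_dvdl (copV b Vb); rewrite def_n dvdn_mulr.
  rewrite Gauss_dvdzl // => /dvdzP[a' def_a]; exists a', b; split=> //.
    by rewrite mulrC -def_a.
  by rewrite -(dvdz_mul2l d_neq0) mulrBr mulrA [d%:Z * a']mulrC -def_a.
have [|/(mulfI d_neq0)-> ->] := injV _ _ b b' Ma Ma' Vb Vb' => //.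
by rewrite def_q -!mulrA -mulrBr dvdz_mul2l.
Qed.

(** For distinct primes [p] and [q] dividing [n], factor [q] as [a * b] modulo [n * p], with [n / p]
    times [a] a multiplier. Then [q] divides [a], being prime to [b], and [a] is nonzero of absolute
    value less than [p]. So [q < p], which is impossible for the least [p]. *)
Lemma unit_factorization_pnat (k1 k2 n : nat) (V : seq int) :
  n = (k1 + k2 + 1)%N -> (1 < n)%N -> unit_factorization k1 k2 n V ->
  (pdiv n).-nat n.
Proof.
move=> def_n n_gt1 ufV; have n_gt0 := ltnW n_gt1.
have aux p q : prime p -> prime q -> (p %| n)%N -> (q %| n)%N -> p != q -> (q < p)%N.
  move=> p_pr q_pr dvd_pn dvd_qn neq_pq.
  have def_np : n = (n %/ p * p)%N by rewrite divnK.
  have [ontoV _] := unit_factorization_dvd ufV def_np n_gt0.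
  have [|a [b [Ma Vb dvd_x]]] := ontoV q%:Z.
    by rewrite dvdzE /= dvdn_prime2.
  have [copV _ _] := ufV.
  have : (q %| a * b)%Z.
    rewrite -[a * b](subKr q%:Z) rpredB //.
    by apply: dvdz_trans dvd_x; rewrite dvdzE /= dvdn_mulr.
  have cop_qb : coprimez q b by apply: coprimez_dvdl (copV b Vb).
  rewrite Gauss_dvdzl // => /dvdzP[c def_a].
  move: Ma; rewrite /mult_set def_a.
  have np_gt0 : (0 < n %/ p)%N by rewrite divn_gt0 ?prime_gt0 // dvdn_leq.
  move: def_np np_gt0; set u := (n %/ p)%N => def_np u_gt0.
  rewrite !mulf_eq0 !negb_or => /andP[/andP[ge_a le_a]] /and3P[_ nz_c _].
  rewrite ltnNge; apply/negP => le_pq.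
  have le_n : (n <= u * q)%N by rewrite {1}def_np leq_mul2l le_pq orbT.
  have def_uq : u%:Z * (c * q%:Z) = (u * q)%N%:Z * c by rewrite PoszM; ring.
  move: ge_a le_a; rewrite def_uq; move: (u * q)%N le_n => w le_n ge_a le_a.
  have [c_ge1 | c_len1] : 1 <= c \/ c <= -1 by lia.
    by nia.
  by nia.
apply/pnatP => // q q_pr dvd_qn; rewrite inE /=.
have [//|neq_pq] := eqVneq (pdiv n) q.
have := aux _ _ (pdiv_prime n_gt1) q_pr (pdiv_dvd n) dvd_qn neq_pq.
by rewrite ltnNge pdiv_min_dvd ?prime_gt1.
Qed.


(** * Odd prime powers *)

Lemma unit_factorization_odd_pfactor (k1 k2 n p e : nat) (V : seq int) :
  n = (k1 + k2 + 1)%N -> (k1 <= k2)%N -> prime p -> odd p -> n = (p ^ e.+2)%N ->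
  ~ unit_factorization k1 k2 n V.
Proof.
move=> def_n le_k p_pr odd_p def_pn ufV; have [copV injV ontoV] := ufV.
(* Chosen so that [n ^ 2 = p ^ k.+1] and [n] visibly divides [p ^ k]. *)
pose k := (e.+2 + e.+1)%N.
have def_q : (n ^ 2)%N = (p ^ k.+1)%N by rewrite def_pn -expnM; congr (_ ^ _)%N; lia.
set q := (n ^ 2)%N in injV ontoV def_q *.
have p_gt1 := prime_gt1 p_pr.
have q_gt1 : (1 < q)%N by rewrite def_q -[1%N](exp1n k.+1) ltn_exp2r.
have cop_q (x : int) : coprimez q x = ~~ (p %| x)%Z.
  by rewrite coprimezE def_q coprime_pexpl // prime_coprime.
have dvd_pq : (p %| q%:Z)%Z by rewrite def_q dvdzE expnS dvdn_mulr.
have unitE (x : int) : ((x%:~R : 'Z_q) \is a GRing.unit) = ~~ (p %| x)%Z.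
  rewrite -cop_q; case: x => j; first by rewrite -pmulrn unitZpE.
  by rewrite NegzE rmorphN /= unitrN -pmulrn unitZpE // coprimezN.
have intr_eq (x y : int) : ((x%:~R : 'Z_q) == y%:~R) = (q %| x - y)%Z.
  by rewrite -intr_Zp_eq0 // rmorphB subr_eq0.
have valE (u : {unit 'Z_q}) : exists2 x : int, val u = x%:~R & ~~ (p %| x)%Z.
  exists (val (val u) : nat)%:Z; first by rewrite -pmulrn natr_Zp.
  by rewrite -unitE -pmulrn natr_Zp; exact: valP.
pose A := [set u : {unit 'Z_q} | [exists i : 'I_n,
  mult_set k1 k2 (i%:Z - k1%:Z) && (val u == (i%:Z - k1%:Z)%:~R)]].
pose B := [set u : {unit 'Z_q} | has (fun b : int => val u == b%:~R) V].
have AP u : reflect (exists2 a, mult_set k1 k2 a & val u = a%:~R) (u \in A).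
  rewrite inE; apply: (iffP existsP) => [[i /andP[Ma /eqP ua]] | [a Ma ua]].
    by exists (i%:Z - k1%:Z).
  have [lt_i def_i] : (`|(a + k1%:Z)%R| < n)%N /\ `|(a + k1%:Z)%R|%N%:Z = a + k1%:Z.
    by move: Ma; rewrite /mult_set; lia.
  by exists (Ordinal lt_i); rewrite /= def_i addrK Ma ua eqxx.
have BP u : reflect (exists2 b, b \in V & val u = b%:~R) (u \in B).
  by rewrite inE; apply: (iffP hasP) => -[b Vb /eqP ub]; exists b => //; exact/eqP.
have AB : (A * B)%g = [set: {unit 'Z_q}].
  apply/setP => u; rewrite [RHS]inE; have [x ux ndvd_x] := valE u.
  have [|a [b [Ma Vb dvd_x]]] := ontoV x.
    apply: contra ndvd_x; apply: dvdz_trans.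
    by rewrite def_pn dvdzE expnS dvdn_mulr.
  have : ~~ (p %| a * b)%Z.
    apply: contra ndvd_x => dvd_ab; rewrite -(subrK (a * b) x) rpredD //.
    exact: dvdz_trans dvd_x.
  rewrite -unitE rmorphM /= unitrM => /andP[Ua Ub].
  apply/mulsgP; exists (FinRing.unit 'Z_q Ua) (FinRing.unit 'Z_q Ub).
  - by apply/AP; exists a.
  - by apply/BP; exists b.
  by apply: val_inj; rewrite /= ux -rmorphM; apply/eqP; rewrite intr_eq.
have injAB : {in setX A B &, injective (fun u => (u.1 * u.2)%g)}.
  move=> [u v] [u' v'] /setXP[/AP[a Ma ua] /BP[b Vb vb]].
  move=> /setXP[/AP[a' Ma' ua'] /BP[b' Vb' vb']] /= /(congr1 val) /= eq_uv.
  have /(injV _ _ _ _ Ma Ma' Vb Vb')[eq_a eq_b] : (q %| a * b - a' * b')%Z.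
    by rewrite -intr_eq !intrM -ua -vb -ua' -vb' /= eq_uv.
  by congr (_, _); apply: val_inj; rewrite ?ua ?ua' ?vb ?vb' (eq_a, eq_b).
(* The cofactor [p.-1] is less than [p], as [cyclic_factorization] requires. *)
have card_units : #|units_Zp q| = (p.-1 * p ^ (e.+2 + e).+1)%N.
  rewrite (card_units_Zp (ltnW q_gt1)) def_q totient_pfactor //.
  by rewrite /k addnS.
have cycU : cyclic [set: {unit 'Z_q}].
  by have := units_Zp_odd_pfactor_cyclic k p_pr odd_p; rewrite /units_Zp -def_q.
have lt_pp : (p.-1 < p)%N by rewrite prednK ?prime_gt0.
have [C AorB [u [v [Cu Cv neq_uv eq_pow]]]] :=
  cyclic_factorization p_pr lt_pp card_units cycU AB injAB.
have close (x y : int) : val u = x%:~R -> val v = y%:~R -> ((p ^ k)%N %| x - y)%Z.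
  move=> ux vy; apply: dvdz_sub_expp => //.
    by rewrite -unitE -vy; exact: valP.
  rewrite -def_q -intr_eq !rmorphXn /= -ux -vy.
  have := congr1 val eq_pow; rewrite /= !FinRing.val_unitX => ->.
  by [].
case: AorB => eqC; move: Cu Cv; rewrite {C}eqC.
  move=> /AP[a Ma ua] /AP[a' Ma' va']; case/negP: neq_uv.
  have dvd_n : (n %| a - a')%Z.
    apply: dvdz_trans (close _ _ ua va'); rewrite dvdzE def_pn /k expnD.
    by rewrite dvdn_mulr.
  suff eq_a : a = a' by apply/eqP/val_inj; rewrite /= ua va' eq_a.
  case: (posnP `|a - a'|) => [|gt0]; first by lia.
  have := dvdn_leq gt0 dvd_n; move: Ma Ma'; rewrite /mult_set; lia.
move=> /BP[b Vb ub] /BP[b' Vb' vb']; case/negP: neq_uv.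
(* Here [p ^ 2 <= n <= 2 * k2 + 1], whence [p <= k2]. *)
have Mp : mult_set k1 k2 p%:Z.
  have : (p ^ 2 <= n)%N by rewrite def_pn leq_exp2l.
  rewrite /mult_set; nia.
have [|_ eq_b] := injV _ _ _ _ Mp Mp Vb Vb'.
  by rewrite -mulrBr def_q expnS PoszM dvdz_mul // close.
by apply/eqP/val_inj; rewrite /= ub vb' eq_b.
Qed.

(** * Powers of two *)

Lemma int_parity (x : int) : exists d, x = 2 * d \/ x = 2 * d + 1.
Proof. by exists (x %/ 2)%Z; lia. Qed.

(** Squaring [1 + u] gives [1 + 2 * u + u ^ 2]. For [u] an odd multiple of [8 * 2 ^ s], the last
    term is an even multiple of [2 * u], so the cofactor stays odd. *)
Lemma exp9_2expn (s : nat) :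
  exists w : int, 9 ^+ (2 ^ s)%N = 1 + 8 * (2 ^ s)%N%:Z * (2 * w + 1).
Proof.
elim: s => [|s [w IHs]]; first by exists 0.
exists (w + 2 * (2 ^ s)%N%:Z * (2 * w + 1) ^+ 2).
by rewrite expnSr exprM IHs PoszM; ring.
Qed.

(* Let q = 16 * 2 ^ s. If x is in C then 3 x is congruent to y + q mod 2 q for
   some y in C, so C is stable under multiplication by 9 mod 2 q. But a power
   of 9 is congruent to 1 + q. *)
Lemma no_triple_free_odd_transversal (C : int -> Prop) (s : nat) :
  let q := 16 * (2 ^ s)%N%:Z in
  (forall x, C x -> exists c, x = 2 * c + 1) ->
  (forall x, (exists c, x = 2 * c + 1) -> exists2 y, C y & (q %| x - y)%Z) ->
  (forall x y, C x -> C y -> (q %| x - y)%Z -> x = y) ->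
  ~ (forall x y, C x -> C y -> ~ (2 * q %| 3 * x - y)%Z).
Proof.
move=> q oddC ontoC injC farC.
have near3 x : C x -> exists2 y, C y & exists c, 3 * x - y = q * (2 * c + 1).
  move=> Cx; have [e def_x] := oddC x Cx.
  have [|y Cy /dvdzP[c def_c]] := ontoC (3 * x).
    by exists (3 * e + 1); rewrite def_x; ring.
  exists y => //; have [d [def_d | def_d]] := int_parity c.
    case: (farC x y Cx Cy); apply/dvdzP; exists d.
    by rewrite def_c def_d; ring.
  by exists d; rewrite def_c def_d; ring.
have step9 x : C x -> exists2 y, C y & (2 * q %| y - 9 * x)%Z.
  case/near3=> y /near3[z Cz [c2 def2z]] [c1 def1y].
  exists z => //; apply/dvdzP; exists (- (3 * c1 + c2 + 2)).
  have -> : z - 9 * x = - (3 * (3 * x - y) + (3 * y - z)) by ring.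
  by rewrite def1y def2z; ring.
have iter9 j x : C x -> exists2 y, C y & (2 * q %| y - 9 ^+ j * x)%Z.
  move=> Cx; elim: j => [|j [y Cy dvd_y]].
    by exists x; rewrite // expr0 mul1r subrr dvdz0.
  have [z Cz dvd_z] := step9 y Cy; exists z => //.
  have -> : z - 9 ^+ j.+1 * x = (z - 9 * y) + 9 * (y - 9 ^+ j * x).
    by rewrite exprS; ring.
  by rewrite rpredD ?dvdz_mull.
have [|x Cx _] := ontoC 1; first by exists 0.
(* With this exponent the power of 9 is 1 plus an odd multiple of [q]. As [x] is odd, [y - x] is an
   odd multiple of [q], while [injC] forces [y = x]. *)
have [y Cy /dvdzP[z def_z]] := iter9 (2 ^ s.+1)%N x Cx.
have [w def9] := exp9_2expn s.+1.
have {}def9 : 9 ^+ (2 ^ s.+1)%N = 1 + q * (2 * w + 1).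
  by rewrite def9 /q expnS PoszM; ring.
have {}def_z : y - x = q * (2 * z + (2 * w + 1) * x).
  by rewrite -[y](subrK (9 ^+ (2 ^ s.+1)%N * x)) def_z def9; ring.
have eq_yx : y = x by apply: injC; rewrite // def_z dvdz_mulr.
have [c def_x] := oddC x Cx.
have q_neq0 : q != 0 by rewrite mulf_neq0 // eqz_nat -lt0n expn_gt0.
have : 2 * z + (2 * w + 1) * x = 0.
  by apply: (mulfI q_neq0); rewrite -def_z eq_yx subrr mulr0.
have -> : 2 * z + (2 * w + 1) * x = 2 * (z + 2 * w * c + w + c) + 1.
  by rewrite def_x; ring.
by move: (_ + c); clear; lia.
Qed.

(** Let [h = 2 ^ s]. The divisor [4 * h] leaves only the multiplier 1, so [V] represents the odd
    residues modulo [16 * h]. If [k1 < 2 * h], then [6 * h <= k2], and the divisor [2 * h] allows 1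
    and 3: no [3 * b] meets [V] modulo [32 * h]. Otherwise it allows 1 and -1, so [V] and its
    negatives together represent the odd residues modulo [32 * h], and the divisor [h] allows 1, -1
    and 3 modulo [64 * h]. *)
Lemma unit_factorization_8_2expn (k1 k2 s : nat) (V : seq int) :
  (8 * 2 ^ s)%N = (k1 + k2 + 1)%N -> (k1 <= k2)%N ->
  ~ unit_factorization k1 k2 (8 * 2 ^ s) V.
Proof.
move=> def_n le_k ufV; have [copV _ _] := ufV.
have : (0 < 2 ^ s)%N by rewrite expn_gt0.
(* The instances at [s.+1] and [s] serve the moduli [32 * h] and [16 * h]; they are taken before
   [2 ^ s] is abstracted. *)
have := @no_triple_free_odd_transversal ^~ s.+1; rewrite expnS /=.
have := @no_triple_free_odd_transversal ^~ s; rewrite /=.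
move: (2 ^ s)%N def_n ufV copV => h def_n ufV copV noC16 noC32 h_gt0.
have n_gt0 : (0 < 8 * h)%N by rewrite muln_gt0.
have oddV b : b \in V -> exists c, b = 2 * c + 1.
  move=> /copV cop_b.
  have : coprimez 2 b by apply: coprimez_dvdl cop_b; rewrite /= dvdn_mulr.
  rewrite coprimezE prime_coprime // => ndvd_b.
  by exists (b %/ 2)%Z; lia.
have def2 : (8 * h = (4 * h) * 2)%N by lia.
have def4 : (8 * h = (2 * h) * 4)%N by lia.
have def8 : (8 * h = h * 8)%N by lia.
have [onto2 inj2] := unit_factorization_dvd ufV def2 n_gt0.
have [_ inj4] := unit_factorization_dvd ufV def4 n_gt0.
have [_ inj8] := unit_factorization_dvd ufV def8 n_gt0.
have q2 : (8 * h * 2)%N%:Z = 16 * h%:Z by rewrite !PoszM; ring.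
have q4 : (8 * h * 4)%N%:Z = 2 * (16 * h%:Z) by rewrite !PoszM; ring.
have q8 : (8 * h * 8)%N%:Z = 2 * (16 * (2 * h)%N%:Z) by rewrite !PoszM; ring.
rewrite q2 in onto2 inj2; rewrite q4 in inj4; rewrite q8 in inj8.
have M (m : nat) (a : int) : - k1%:Z <= m%:Z * a -> m%:Z * a <= k2%:Z ->
    (0 < m)%N -> a != 0 -> mult_set k1 k2 (m%:Z * a).
  move=> ge_a le_a m_gt0 nz_a; rewrite /mult_set ge_a le_a mulf_neq0 //.
  by rewrite eqz_nat -lt0n.
have inj_V b b' : b \in V -> b' \in V -> (16 * h%:Z %| b - b')%Z -> b = b'.
  move=> Vb Vb' dvd_b.
  have M1 : mult_set k1 k2 ((4 * h)%N%:Z * 1) by apply: M; lia.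
  by have [|_ ->//] := inj2 1 1 b b' M1 M1 Vb Vb'; rewrite !mul1r.
have onto_V x : (exists c, x = 2 * c + 1) ->
    exists2 b, b \in V & (16 * h%:Z %| x - b)%Z.
  case=> c def_x; have [|a [b [Ma Vb dvd_x]]] := onto2 x.
    by rewrite def_x; clear; lia.
  exists b => //; suff a1 : a = 1 by rewrite a1 mul1r in dvd_x.
  move: Ma; rewrite /mult_set PoszM -mulrA => /andP[/andP[ge_a le_a] nz_a].
  have nz : a != 0 by apply: contraNneq nz_a => ->; rewrite !mulr0.
  (* The other values fail because [k2 < 8 * h] and [k1 < 4 * h]. *)
  have [a_ge2 | [a_leN1 | //]] : 2 <= a \/ a <= -1 \/ a = 1 by lia.
    by nia.
  by nia.
have [lt_k1 | ge_k1] := ltnP k1 (2 * h).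
  apply: (noC16 (fun b => b \in V)) => // b b' Vb Vb' dvd_b.
  have M1 : mult_set k1 k2 ((2 * h)%N%:Z * 1) by apply: M; lia.
  have M3 : mult_set k1 k2 ((2 * h)%N%:Z * 3) by apply: M; lia.
  by have [|] := inj4 3 1 b b' M3 M1 Vb Vb'; rewrite ?mul1r.
pose C x := x \in V \/ - x \in V.
have q32 : 2 * (16 * h%:Z) = 16 * (2 * h)%N%:Z by rewrite PoszM; ring.
rewrite q32 in inj4.
have neg_V b b' : b \in V -> b' \in V -> ~ (16 * (2 * h)%N%:Z %| b + b')%Z.
  have M1 : mult_set k1 k2 ((2 * h)%N%:Z * 1) by apply: M; lia.
  have MN1 : mult_set k1 k2 ((2 * h)%N%:Z * -1) by apply: M; lia.
  move=> Vb Vb' dvd_b; have [] := inj4 1 (-1) b b' M1 MN1 Vb Vb' => //.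
  by rewrite mul1r mulN1r opprK.
have M1 : mult_set k1 k2 (h%:Z * 1) by apply: M; lia.
have MN1 : mult_set k1 k2 (h%:Z * -1) by apply: M; lia.
have M3 : mult_set k1 k2 (h%:Z * 3) by apply: M; lia.
have far3 b b' : b \in V -> b' \in V ->
    ~ (2 * (16 * (2 * h)%N%:Z) %| 3 * b - b')%Z
    /\ ~ (2 * (16 * (2 * h)%N%:Z) %| 3 * b + b')%Z.
  move=> Vb Vb'; split=> dvd_b.
    by have [|] := inj8 3 1 b b' M3 M1 Vb Vb'; rewrite ?mul1r.
  by have [|] := inj8 3 (-1) b b' M3 MN1 Vb Vb'; rewrite ?mulN1r ?opprK.
apply: (noC32 C).
- move=> x [] /oddV[c def_x]; first by exists c.
  by exists (- c - 1); rewrite -[x]opprK def_x; ring.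
(* If both quotients, for [x] and for [- x], are odd, then [b + b'] is a multiple of [32 * h],
   against [neg_V]. *)
- move=> x odd_x; have [b Vb /dvdzP[c def_c]] := onto_V x odd_x.
  have [d [def_d | def_d]] := int_parity c.
    exists b; first by left.
    by apply/dvdzP; exists d; rewrite def_c def_d PoszM; ring.
  have [|b' Vb' /dvdzP[c' def_c']] := onto_V (- x).
    by case: odd_x => e ->; exists (- e - 1); ring.
  have [d' [def_d' | def_d']] := int_parity c'.
    exists (- b'); first by right; rewrite opprK.
    apply/dvdzP; exists (- d').
    have -> : x - - b' = - (- x - b') by ring.
    by rewrite def_c' def_d' PoszM; ring.
  case: (neg_V b b' Vb Vb'); apply/dvdzP; exists (- (d + d' + 1)).
  have -> : b + b' = - ((x - b) + (- x - b')) by ring.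
  by rewrite def_c def_c' def_d def_d' PoszM; ring.
- move=> x y Cx Cy dvd_xy.
  have dvd16 : (16 * h%:Z %| x - y)%Z.
    by apply: dvdz_trans dvd_xy; rewrite -q32 dvdz_mull.
  case: Cx Cy => Vx [] Vy; first exact: inj_V.
  + by case: (neg_V _ _ Vx Vy).
  + by case: (neg_V _ _ Vx Vy); rewrite -rpredN opprD opprK.
  by apply/oppr_inj/inj_V; rewrite // -rpredN opprB opprK addrC.
move=> x y [] Vx [] Vy dvd_xy; have [far_sub far_add] := far3 _ _ Vx Vy.
- exact: far_sub.
- by apply: far_add.
- by apply: far_add; rewrite -rpredN opprD mulrN opprK.
by apply: far_sub; rewrite -rpredN opprB mulrN opprK addrC.
Qed.

(** * Combination of the cases *)

Theorem theorem3p3 (k1 k2 : nat) :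
  (1 <= k1)%N -> (k1 <= k2)%N -> (3 <= k2)%N ->
  ~~ prime (k1 + k2 + 1) ->
  ~ (exists B : {set 'I_((k1 + k2 + 1) ^ 2)},
       perfect_splitter_set k1 k2 ((k1 + k2 + 1) ^ 2) B).
Proof.
move=> k1_gt0 le_k k2_ge3 nprime_n [B perfB].
have n_gt1 : (1 < k1 + k2 + 1)%N by lia.
have [V ufV] := perfect_unit_factorization erefl n_gt1 perfB.
have p_pr := pdiv_prime n_gt1.
have [e def_n] := p_natP (unit_factorization_pnat erefl n_gt1 ufV).
(* Exponent 0 contradicts [n_gt1], and exponent 1 would make the number prime. *)
case: e def_n => [|[|e]] def_n; first by rewrite def_n in n_gt1.
  by rewrite def_n expn1 p_pr in nprime_n.
have [p2 | odd_p] := even_prime p_pr; last first.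
  exact: (unit_factorization_odd_pfactor erefl le_k p_pr odd_p def_n ufV).
(* The remaining small power is 4, while [k1 + k2 + 1] is at least 5. *)
rewrite p2 in def_n; case: e def_n => [|e] def_n; first by lia.
have def8 : (8 * 2 ^ e)%N = (k1 + k2 + 1)%N by rewrite def_n !expnS !mulnA.
by apply: (unit_factorization_8_2expn def8 le_k (V := V)); rewrite def8.
Qed.
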